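(* Let $G$ be a finite directed multigraph and let $q,s:V(G)\to\mathbb{Z}_{\ge 0}$ be a quota and a start portfolio. Then $(G,q,s)$ admits an exact quota forest if and only if all of the following hold: $q(v)\ge s(v)$ for each $v\in V(G)$; $(G,q,s)$ is connected; and the enough arrows condition $s(w)+\sum_{v} q(v)\,m_{vw}\ge q(w)$ holds at each vertex $w\in V(G)$, where $m_{vw}$ is the number of edges of $G$ from $v$ to $w$.
   Context: A directed multigraph $G=(V,E,i,t)$ has a vertex set $V=V(G)$, an edge set $E$, and maps $i,t:E\to V$ giving the initial and terminal vertex of each edge; loops and multiple (distinguishable) edges are allowed. A map $f:G\to H$ of multigraphs sends vertices to vertices and edges to edges and respects $i$ and $t$. It is an immersion if for every vertex $v$ it maps the set of outgoing edges of $v$ injectively into the set of outgoing edges of $f(v)$. A quota tree with root $*\in V(G)$ and quota $q$ is an immersion $f:T\to G$, where $T$ is a finite rooted tree with all edges directed away from its root, such that the root of $T$ maps to $*$ and $|f^{-1}(v)|=q(v)$ for all $v\in V(G)$. An exact quota forest for $(G,q,s)$ is a disjoint union of quota trees $\{T_{v,i}\mid v\in V(G),\ 1\le i\le s(v)\}$ such that the root of $T_{v,i}$ maps to $v$ and the sum of the quotas of the component trees is $q$. $(G,q,s)$ is connected if for every vertex $v$ with $q(v)>0$ there exist a vertex $u$ with $s(u)>0$ and a directed path (possibly of length zero) from $u$ to $v$ in the subgraph of $G$ induced by $\{x\in V(G): q(x)>0\}$. *)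

(* Defs.v *)
From mathcomp Require Import all_boot.

Set Implicit Arguments.
Unset Strict Implicit.
Unset Printing Implicit Defensive.

(* Finite directed multigraphs: loops and parallel edges are allowed. *)
Record multigraph := Multigraph {
  vert : finType;
  edge : finType;
  ini : edge -> vert;
  ter : edge -> vert
}.

Arguments ini {m} _.
Arguments ter {m} _.

Record gmap (G H : multigraph) := GMap {
  vmap : vert G -> vert H;
  emap : edge G -> edge H;
  gmap_ini : forall e : edge G, ini (emap e) = vmap (ini e);
  gmap_ter : forall e : edge G, ter (emap e) = vmap (ter e)
}.

Definition immersion (G H : multigraph) (f : gmap G H) : Prop :=
  forall v : vert G, {in [pred e | ini e == v] &, injective (emap f)}.

(* Undirected walks: a dart (e, b) is the edge e traversed forwards if b is
   true, and backwards otherwise. *)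
Section Walks.
Variable G : multigraph.

Definition dart : Type := (edge G * bool)%type.

Definition dsrc (d : dart) : vert G := if d.2 then ini d.1 else ter d.1.
Definition dtgt (d : dart) : vert G := if d.2 then ter d.1 else ini d.1.

Fixpoint walk (x : vert G) (p : seq dart) (y : vert G) : bool :=
  if p is d :: p' then (dsrc d == x) && walk (dtgt d) p' y else x == y.

(* No edge is used twice, not even in opposite directions. *)
Definition edge_simple (p : seq dart) : bool := uniq [seq d.1 | d <- p].

(* A loop is a cycle of length 1, a pair of parallel or opposite edges is a
   cycle of length 2. *)
Definition is_cycle (x : vert G) (p : seq dart) : bool :=
  [&& p != [::], walk x p x, edge_simple p & uniq [seq dsrc d | d <- p]].

Definition is_tree : Prop :=
  (forall x y : vert G, exists p : seq dart, walk x p y) /\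
  (forall (x : vert G) (p : seq dart), ~~ is_cycle x p).

Definition directed_away_from (r : vert G) : Prop :=
  forall (y : vert G) (p : seq dart),
    walk r p y -> edge_simple p -> all (fun d => d.2) p.

End Walks.

Record quota_tree (G : multigraph) (root : vert G) (q : vert G -> nat) :=
  QuotaTree {
    qt_graph : multigraph;
    qt_root : vert qt_graph;
    qt_is_tree : is_tree qt_graph;
    qt_directed : directed_away_from qt_root;
    qt_map : gmap qt_graph G;
    qt_immersion : immersion qt_map;
    qt_rootE : vmap qt_map qt_root = root;
    qt_quota : forall v : vert G,
      #|[set x : vert qt_graph | vmap qt_map x == v]| = q v
  }.

(* The disjoint union of the trees is kept as the family of its components,
   indexed by the pairs (v, i) with i < s v. *)
Record exact_quota_forest (G : multigraph) (q s : vert G -> nat) :=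
  ExactQuotaForest {
    qf_quota : forall v : vert G, 'I_(s v) -> vert G -> nat;
    qf_tree : forall (v : vert G) (i : 'I_(s v)), quota_tree v (qf_quota i);
    qf_sum : forall w : vert G,
      \sum_(v : vert G) \sum_(i < s v) qf_quota i w = q w
  }.

(* Adjacency in the subgraph of G induced by the support of q. *)
Definition supp_adj (G : multigraph) (q : vert G -> nat) : rel (vert G) :=
  fun x y => [&& 0 < q x, 0 < q y & [exists e : edge G, (ini e == x) && (ter e == y)]].

Definition quota_connected (G : multigraph) (q s : vert G -> nat) : Prop :=
  forall v : vert G, 0 < q v ->
    exists u : vert G, 0 < s u /\ connect (supp_adj q) u v.

Definition arrows (G : multigraph) (v w : vert G) : nat :=
  #|[set e : edge G | (ini e == v) && (ter e == w)]|.

(* Main.v *)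
Require Import Defs.
From mathcomp Require Import all_boot perm.

(** Necessity is counting.  Every vertex of a quota tree other than its root
    is the terminal vertex of a tree edge, and the immersion property makes the
    pair (initial vertex in the tree, image edge in G) determine that tree edge;
    so the non-root vertices lying over w are at most as many as the pairs
    (tree vertex x, edge of G from the image of x to w), which is the enough
    arrows condition for a single tree ([quota_tree_arrows]).  Connectivity
    comes from the image of the directed path from the root.

    For sufficiency, take q(v) copies of each vertex v and declare the first
    s(v) of them to be roots.  A slot over w is a pair (copy x of v, edge of G
    from v to w).  The enough arrows condition says exactly that the non-root
    copies can be given pairwise distinct slots ([assignment_exists]); the first
    component of a slot is a parent, and distinctness of the slots is the
    immersion property.  The resulting parent relation is a forest, except that
    some copies may sit in components that contain a cycle instead of a root.
    Call a copy grounded if its ancestors include a root.  As long as some copy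
    is not grounded, the set of grounded copies can be strictly enlarged
    ([grounded_extend]).  Pick a copy y on a cycle.
    - If a grounded copy x lies over the same vertex as y, exchange the
      children of x and y: the cycle is cut open at y and spliced in below x
      ([swap_children]).
    - Otherwise follow a path of G from a start vertex to the vertex under y.
      Somewhere it takes an edge from a vertex with a grounded copy x to a
      vertex without any; the slot of that edge at x is then free, and any copy
      over its terminal vertex can be moved there ([reattach]).
    Once all copies are grounded, the copies below each root, with one edge for
    each non-root copy, form the required quota trees. *)

Set Implicit Arguments.
Unset Strict Implicit.
Unset Printing Implicit Defensive.

(** * Walks *)

Section WalkTheory.
Variable G : multigraph.
Implicit Types (x y z : vert G) (p : seq (dart G)).

Lemma walk_cat x p y p' z : walk x p y -> walk y p' z -> walk x (p ++ p') z.
Proof.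
elim: p x => [|d p IHp] x /= => [/eqP-> //|/andP[-> xpy] yp'z].
exact: IHp yp'z.
Qed.

Lemma walk_catP x p p' z :
  walk x (p ++ p') z -> exists2 y, walk x p y & walk y p' z.
Proof.
elim: p x => [|d p IHp] x /=; first by move=> ?; exists x.
by case/andP=> -> /IHp.
Qed.

(** Shortcutting: if the first edge is used again later on, the walk can
    resume there, either with that second traversal (same direction) or just
    after it (opposite direction). *)
Lemma walk_edge_simple x p y :
  walk x p y -> exists2 p', walk x p' y & edge_simple p'.
Proof.
elim: p x => [|d p IHp] x /=; first by move/eqP->; exists [::] => /=.
case/andP=> /eqP xd /IHp[p' dp'y simp'].
have [/mapP[d' d'p' dd'] | dNp'] := boolP (d.1 \in [seq d.1 | d <- p']);
  last by exists (d :: p'); rewrite /= ?xd ?eqxx // /edge_simple /= dNp'.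
case/splitPr: d'p' dp'y simp' => p1 p2 /walk_catP[z _ /= /andP[_ d'p2y]].
rewrite /edge_simple map_cat cat_uniq => /and3P[_ _ simp2].
have [bb'|bb'] := eqVneq d.2 d'.2.
  by exists (d' :: p2) => //=; rewrite d'p2y andbT -xd /dsrc dd' bb'.
exists p2; last by move: simp2 => /= /andP[].
suff <- : dtgt d' = x by [].
by rewrite -xd /dtgt /dsrc dd'; case: (d.2) (d'.2) bb' => [] [].
Qed.

Lemma walk_last x (d : dart G) p y : walk x (d :: p) y -> dtgt (last d p) = y.
Proof.
elim: p x d => [|d' p IHp] x d /=; first by case/andP=> _ /eqP.
by case/andP=> _; apply: IHp.
Qed.

End WalkTheory.

(** * A criterion for rooted trees *)

Section Arborescence.
Variables (T : multigraph) (r : vert T) (depth : vert T -> nat).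
Hypothesis ter_inj : injective (@ter T).
Hypothesis depth_ter : forall e : edge T, depth (ter e) = (depth (ini e)).+1.
Hypothesis depth_root : depth r = 0.
Hypothesis in_edge : forall x : vert T, x = r \/ exists e : edge T, ter e = x.

(** A backward step just after a forward one leaves a vertex through an edge
    ending there, and as [ter] is injective this is the edge just used. *)
Lemma forward_continues x (d : dart T) p y :
  walk x (d :: p) y -> edge_simple (d :: p) -> d.2 ->
  all (fun d => d.2) (d :: p).
Proof.
elim: p x d => [|d' p IHp] x d /=; first by move=> _ _ ->.
case/and3P=> _ /eqP dd' d'py simp fd; rewrite fd /=.
apply: (IHp (dsrc d')) => /=; first by rewrite eqxx.
  by case/andP: simp.
move: dd' simp; rewrite /edge_simple /= inE /dsrc /dtgt fd.
by case: (d'.2) => // /ter_inj->; rewrite eqxx.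
Qed.

Lemma forward_depth x p y :
  walk x p y -> all (fun d : dart T => d.2) p -> depth y = depth x + size p.
Proof.
elim: p x => [|d p IHp] x /= => [/eqP-> //|/andP[/eqP<- dpy] /andP[fd fp]].
  by rewrite addn0.
by rewrite (IHp _ dpy fp) /dtgt /dsrc fd depth_ter addSnnS.
Qed.

Lemma backward_depth x p y :
  walk x p y -> all (fun d : dart T => ~~ d.2) p -> depth x = depth y + size p.
Proof.
elim: p x => [|d p IHp] x /= => [/eqP-> //|/andP[/eqP<- dpy] /andP[bd bp]].
  by rewrite addn0.
have := IHp _ dpy bp; rewrite /dtgt /dsrc (negPf bd) depth_ter addnS.
by move->.
Qed.

(** An edge-simple closed walk consists of backward steps followed by forward
    steps.  By the depth function both kinds occur, so its first edge and its
    last one both end at the base point, hence are one edge used twice. *)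
Lemma arborescence_tree : is_tree T.
Proof.
split=> [x y|x p].
  have conn z : (exists p, walk r p z) /\ (exists p, walk z p r).
    elim: {z}(depth z) {-2}z (erefl (depth z)) => [|n IHn] z;
      (case: (in_edge z) => [->|[e <-]]; first by split; exists [::] => /=);
      rewrite depth_ter // => -[/IHn[[p rpe] [p' ep'r]]].
    split; last by exists ((e, false) :: p'); rewrite /= /dsrc /dtgt /= eqxx.
    exists (p ++ [:: (e, true)]).
    by apply: walk_cat rpe _; rewrite /= /dsrc /dtgt /= !eqxx.
  have [[_ [p xpr]] [[p' rp'y] _]] := (conn x, conn y).
  by exists (p ++ p'); apply: walk_cat rp'y.
apply/negP=> /and4P[p_neq0 xpx simp _].
have noforward : ~~ all (fun d : dart T => d.2) p.
  apply/negP=> /(forward_depth xpx)/eqP; rewrite -{1}[depth x]addn0 eqn_add2l.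
  by rewrite eq_sym size_eq0 (negPf p_neq0).
have [/hasP[d1 d1p fd1]|] := boolP (has (fun d : dart T => d.2) p); last first.
  rewrite -all_predC => /(backward_depth xpx)/eqP; rewrite -{1}[depth x]addn0.
  by rewrite eqn_add2l eq_sym size_eq0 (negPf p_neq0).
case/splitPr: d1p xpx simp noforward {p_neq0} => -[|d p1] p2 xpx simp.
  by rewrite (forward_continues xpx simp fd1).
rewrite cat_cons in xpx simp *; move=> noforward.
have bd : ~~ d.2 by apply: contra noforward; apply: forward_continues xpx simp.
have [z _ zp2x] := walk_catP (p := d :: p1) xpx.
have simp2 : edge_simple (d1 :: p2).
  by move: simp; rewrite /edge_simple -cat_cons map_cat cat_uniq => /and3P[].
have /allP/(_ _ (mem_last _ _)) := forward_continues zp2x simp2 fd1.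
move: (walk_last zp2x) xpx simp; rewrite /= /dtgt /dsrc (negPf bd).
move=> dl /andP[/eqP dx _]; rewrite /edge_simple /= => /andP[dN _] fl.
rewrite fl -dx in dl; case/mapP: dN; exists (last d1 p2).
  by rewrite mem_cat mem_last orbT.
by rewrite (ter_inj dl).
Qed.

Lemma arborescence_directed : directed_away_from r.
Proof.
move=> y [|d p] // rpy simp; apply: (forward_continues rpy simp).
move: rpy => /= /andP[/eqP dr _]; move: depth_root.
by rewrite -dr /dsrc; case: (d.2) => //; rewrite depth_ter.
Qed.

End Arborescence.

(** * Counting slots *)

Section SlotCount.
Variables (G : multigraph) (X : finType) (f : X -> vert G).

(** The slots over w are the places where a vertex over w can be attached as a
    child: under a given x, along a given edge of G leaving the image of x. *)
Definition slots (w : vert G) : {set X * edge G} :=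
  [set pe | (ini pe.2 == f pe.1) && (ter pe.2 == w)].

Lemma card_slots w :
  #|slots w| = \sum_(v : vert G) #|[set x | f x == v]| * arrows v w.
Proof.
rewrite -sum1dep_card -(pair_big_dep xpredT
  (fun x e => (ini e == f x) && (ter e == w)) (fun _ _ => 1)) /=.
rewrite (partition_big f predT) //=; apply: eq_bigr => v _.
rewrite -sum1dep_card big_distrl /=; apply: eq_bigr => x /eqP fxv.
by rewrite mul1n sum1dep_card fxv.
Qed.

End SlotCount.

(** * Necessity of the three conditions *)

Section QuotaTreeNecessity.
Variables (G : multigraph) (root : vert G) (q0 : vert G -> nat).
Variable T : quota_tree root q0.

Let f := vmap (qt_map T).
Let r := qt_root T.

Lemma quota_tree_root : 0 < q0 root.
Proof.
rewrite -(qt_quota T) card_gt0; apply/set0Pn; exists r.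
by rewrite inE (qt_rootE T).
Qed.

Lemma quota_tree_forward_walk x :
  exists2 p, walk r p x & all (fun d : dart _ => d.2) p.
Proof.
have [[conn _] away] := (qt_is_tree T, @qt_directed _ _ _ T).
have [p /walk_edge_simple[p' rp'x simp]] := conn r x.
by exists p' => //; apply: away rp'x simp.
Qed.

Lemma quota_tree_connect (q : vert G -> nat) v :
  (forall w, q0 w <= q w) -> 0 < q0 v -> connect (supp_adj q) root v.
Proof.
move=> le_q; rewrite -(qt_quota T) card_gt0 => /set0Pn[x].
rewrite inE => /eqP<-.
suff: connect (supp_adj q) (f r) (f x) by rewrite /f /r (qt_rootE T).
have q_gt0 y : 0 < q (f y).
  apply: leq_trans (le_q _); rewrite -(qt_quota T) card_gt0.
  by apply/set0Pn; exists y; rewrite inE.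
have [p] := quota_tree_forward_walk x.
elim: p (r) => [|d p IHp] y /=; first by move/eqP->.
case/andP=> /eqP<- dpx /andP[fd fp]; apply: connect_trans (IHp _ dpx fp).
rewrite /dsrc /dtgt fd; apply: connect1; rewrite /supp_adj !q_gt0 /=.
by apply/existsP; exists (emap (qt_map T) d.1); rewrite gmap_ini gmap_ter !eqxx.
Qed.

Lemma quota_tree_arrows w :
  q0 w <= (root == w) + \sum_v q0 v * arrows v w.
Proof.
rewrite -[q0 w](qt_quota T) (cardsD1 r) inE (qt_rootE T) leq_add2l.
(* Both sides are compared with the tree edges whose end lies over w. *)
pose Ew := [set e : edge (qt_graph T) | f (ter e) == w].
apply: (@leq_trans #|Ew|).
  apply: leq_trans (leq_imset_card (@ter _) _); apply/subset_leq_card/subsetP.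
  move=> x; rewrite !inE => /andP[xNr fx].
  have [p] := quota_tree_forward_walk x.
  case/lastP: p => [/eqP/esym/eqP|p d]; first by rewrite (negPf xNr).
  rewrite all_rcons -cats1 => /walk_catP[z _ /=] /andP[_ /eqP tdx] /andP[fd _].
  by apply/imsetP; exists d.1; rewrite ?inE /f -tdx /dtgt fd // in fx *.
under eq_bigr => v _ do rewrite -[q0 v](qt_quota T).
rewrite -card_slots -(@card_in_imset _ _ (fun e => (ini e, emap (qt_map T) e))).
  apply/subset_leq_card/subsetP => _ /imsetP[e + ->]; rewrite !inE /=.
  by rewrite gmap_ini gmap_ter eqxx.
move=> e e' _ _ [iniE emE]; apply: (qt_immersion (v := ini e')) emE => //.
  by rewrite inE iniE.
by rewrite inE.
Qed.

End QuotaTreeNecessity.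

Section ForestNecessity.
Variables (G : multigraph) (q s : vert G -> nat).
Variable F : exact_quota_forest q s.

Lemma component_quota_le v (i : 'I_(s v)) w : qf_quota F i w <= q w.
Proof.
by rewrite -(qf_sum F) (bigD1 v) //= (bigD1 i) //= -addnA leq_addr.
Qed.

Lemma forest_starts v : s v <= q v.
Proof.
rewrite -(qf_sum F) (bigD1 v) //=; apply: leq_trans (leq_addr _ _).
rewrite -[X in X <= _]card_ord -sum1_card; apply: leq_sum => i _.
exact: quota_tree_root (qf_tree F i).
Qed.

Lemma forest_connected : quota_connected q s.
Proof.
move=> v; rewrite -(qf_sum F) lt0n sum_nat_eq0 negb_forall.
case/existsP=> u; rewrite implyTb sum_nat_eq0 negb_forall.
case/existsP=> i; rewrite implyTb -lt0n => qv.
exists u; split; first exact: leq_ltn_trans (ltn_ord i).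
exact (quota_tree_connect (qf_tree F i) (component_quota_le i) qv).
Qed.

Lemma forest_arrows w : q w <= s w + \sum_v q v * arrows v w.
Proof.
(* As s w is the number of trees whose root lies over w, the inequality is the
   sum over all trees of the inequality for a single tree. *)
have -> : s w = \sum_v \sum_(i < s v) (v == w).
  under eq_bigr => v _ do rewrite sum_nat_const card_ord.
  rewrite (bigD1 w) //= eqxx muln1 big1 ?addn0 // => v /negPf->.
  by rewrite muln0.
under [X in _ + X]eq_bigr => v _ do rewrite -(qf_sum F) big_distrl /=.
rewrite exchange_big -big_split -[leqLHS](qf_sum F) /=; apply: leq_sum => v _.
under [X in _ + X]eq_bigr => u _ do rewrite big_distrl /=.
rewrite exchange_big -big_split /=; apply: leq_sum => i _.
exact: quota_tree_arrows (qf_tree F i) w.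
Qed.

End ForestNecessity.

(** * Parent assignments and their improvement *)

Section Assignment.
Variables (G : multigraph) (X : finType) (f : X -> vert G) (R : {set X}).
Implicit Types (a : X -> option (X * edge G)) (x y z : X).

(** [a x] is the slot in which x hangs, and [None] for the roots.  Injectivity
    is what makes the resulting maps to G immersions. *)
Definition assignment a : Prop :=
  [/\ forall x, (a x == None) = (x \in R),
      forall x pe, a x = Some pe -> pe \in slots f (f x)
    & forall x y pe, a x = Some pe -> a y = Some pe -> x = y].

(** A root is its own parent, so that ancestors are iterates of a total map. *)
Definition parent a x : X := if a x is Some pe then pe.1 else x.

Definition grounded a : {set X} :=
  [set x | [exists r in R, fconnect (parent a) x r]].

Lemma parentE a x pe : a x = Some pe -> parent a x = pe.1.
Proof. by rewrite /parent => ->. Qed.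

Lemma grounded_root a : R \subset grounded a.
Proof.
by apply/subsetP=> r rR; rewrite inE; apply/exists_inP; exists r.
Qed.

Section Fixed.
Variable a : X -> option (X * edge G).
Hypothesis a_ok : assignment a.

Lemma assignment_root x : x \in R -> a x = None.
Proof. by case: a_ok => aR _ _; rewrite -aR => /eqP. Qed.

Lemma assignment_nonroot x : x \notin R -> exists pe, a x = Some pe.
Proof.
by case: a_ok => aR _ _; rewrite -aR; case: (a x) => // pe _; exists pe.
Qed.

Lemma grounded_iter x :
  reflect (exists n, iter n (parent a) x \in R) (x \in grounded a).
Proof.
rewrite inE; apply: (iffP existsP) => [[r /andP[rR xr]]|[n xn]].
  by exists (findex (parent a) x r); rewrite iter_findex.
by exists (iter n (parent a) x); rewrite xn fconnect_iter.
Qed.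

Lemma grounded_child c pe :
  a c = Some pe -> (c \in grounded a) = (pe.1 \in grounded a).
Proof.
move=> ac; rewrite -(parentE ac); apply/grounded_iter/grounded_iter => -[n].
  case: n => [/assignment_root|n]; first by rewrite /= ac.
  by rewrite iterSr; exists n.
by exists n.+1; rewrite iterSr.
Qed.

Lemma descendant_ind (S : {set X}) x n :
    (forall c pe, a c = Some pe -> pe.1 \in S -> c \in S) ->
  iter n (parent a) x \in S -> x \in S.
Proof.
move=> Sc; elim: n x => // n IHn x; rewrite iterSr => /IHn.
by rewrite /parent; case ax: (a x) => [pe|] //; apply: Sc ax.
Qed.

Lemma grounded_sub (S : {set X}) :
    R \subset S -> (forall c pe, a c = Some pe -> pe.1 \in S -> c \in S) ->
  grounded a \subset S.
Proof.
move=> RS Sc; apply/subsetP=> x /grounded_iter[n /(subsetP RS)].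
exact: descendant_ind.
Qed.

(** Among the ungrounded copies take c with the fewest ancestors, and let y be
    its parent.  The ancestors of y are among those of c and are not fewer, so
    they include c. *)
Lemma ungrounded_cycle y0 :
    y0 \notin grounded a ->
  exists y c e, [/\ y \notin grounded a, a c = Some (y, e)
                  & fconnect (parent a) y c].
Proof.
move=> y0N; pose anc x := #|fconnect (parent a) x|.
case: (@arg_minnP _ y0 [pred x | x \notin grounded a] anc y0N) => c cN cmin.
have cNR : c \notin R by apply: contra cN; apply/subsetP/grounded_root.
have [[y e] ac] := assignment_nonroot cNR; exists y, c, e.
have yN : y \notin grounded a by rewrite -(grounded_child ac).
split=> //; have cy : fconnect (parent a) c y.
  by rewrite -[y]/(y, e).1 -(parentE ac) fconnect1.
have sub : fconnect (parent a) y \subset fconnect (parent a) c.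
  by apply/subsetP=> z; apply: connect_trans cy.
have /subset_cardP/(_ sub)/(_ c) : anc y = anc c.
  by apply/eqP; rewrite eqn_leq cmin // andbT subset_leq_card.
by rewrite -topredE /= => ->; apply: connect0.
Qed.

End Fixed.

(** If no copy over the vertex of y is grounded, the slot (x, e) is free, for
    whatever occupied it would be a grounded copy over that vertex.  Moving y
    there affects no grounded copy. *)
Lemma reattach a x y (e : edge G) :
    assignment a ->
    x \in grounded a -> y \notin grounded a -> ini e = f x -> ter e = f y ->
    (forall z, z \in grounded a -> f z != f y) ->
  exists2 a', assignment a' & grounded a \proper grounded a'.
Proof.
move=> a_ok xG yN ex ey free; have [aR a_slot a_inj] := a_ok.
have yNR : y \notin R by apply: contra yN; apply/subsetP/grounded_root.
have unused z : a z <> Some (x, e).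
  move=> az; have zG : z \in grounded a by rewrite (grounded_child a_ok az).
  have := a_slot _ _ az; rewrite inE ey /= andbC eq_sym.
  by rewrite (negPf (free z zG)).
pose a' z := if z == y then Some (x, e) else a z.
have a'_ok : assignment a'.
  split=> [z|z pe|z z' pe]; rewrite /a'.
  - by case: (z =P y) => [->|_]; rewrite ?aR // (negPf yNR).
  - case: (z =P y) => [-> [<-]|_]; last exact: a_slot.
    by rewrite inE /= ex ey !eqxx.
  - case: (z =P y) => [->|_]; case: (z' =P y) => [->|_] //; last exact: a_inj.
      by move=> [<-] /unused.
    by move=> az [exe]; case: (unused z); rewrite exe.
have sub : grounded a \subset grounded a'.
  suff: grounded a \subset grounded a :&: grounded a' by rewrite subsetI subxx.
  apply: grounded_sub => [|c pe ac].
    by rewrite subsetI !grounded_root.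
  move=> /setIP[pG pG']; have cG : c \in grounded a.
    by rewrite (grounded_child a_ok ac).
  rewrite inE cG (grounded_child a'_ok (pe := pe)) // /a'.
  by case: (c =P y) cG yN => // -> ->.
exists a' => //; apply/properP; split=> //; exists y => //.
rewrite (grounded_child a'_ok (pe := (x, e))) ?(subsetP sub) //.
by rewrite /a' eqxx.
Qed.

(** From parent to child, let [y -> c -> ... -> y] be the cycle.  Exchanging the
    slots at x with the corresponding slots at y turns it into a path
    [x -> c -> ... -> y], and the former children of x continue below y. *)
Lemma swap_children a x y c (e : edge G) :
    assignment a -> x \in grounded a -> y \notin grounded a -> f x = f y ->
    a c = Some (y, e) -> fconnect (parent a) y c ->
  exists2 a', assignment a' & grounded a \proper grounded a'.
Proof.
move=> a_ok xG yN fxy ac yc; have [aR a_slot a_inj] := a_ok.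
pose t := tperm x y.
have ft z : f (t z) = f z by rewrite /t; case: tpermP => [->|->|].
pose a' z := omap (fun pe => (t pe.1, pe.2)) (a z).
have a'_ok : assignment a'.
  split=> [z|z pe|z z' pe]; rewrite /a'.
  - by rewrite -aR; case: (a z).
  - case az: (a z) => [pe'|] // [<-].
    by have := a_slot _ _ az; rewrite !inE /= ft.
  - case az: (a z) => [[p d]|] // [<-] /=; case az': (a z') => [[p' d']|] //.
    by case=> /perm_inj pp' dd'; apply: a_inj az _; rewrite az' pp' dd'.
have child' z pe :
    a z = Some pe -> (z \in grounded a') = (t pe.1 \in grounded a').
  move=> az; apply: (grounded_child a'_ok (pe := (t pe.1, pe.2))).
  by rewrite /a' az.
(* The old path from a root down to x meets neither x nor y before its end, so
   it survives the exchange. *)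
have xG' : x \in grounded a'.
  apply: contraLR isT => xN'.
  suff: grounded a \subset grounded a :&: grounded a'.
    by move/subsetP/(_ x xG); rewrite inE (negPf xN') andbF.
  apply: grounded_sub => [|z pe az].
    by rewrite subsetI !grounded_root.
  case/setIP=> pG pG'; rewrite inE (grounded_child a_ok az) pG (child' _ _ az).
  rewrite /t tpermD //; first by apply: contraNneq xN' => ->.
  by apply: contraNneq yN => ->.
(* Now c is a child of x, and the way from c down to y, which consists of
   ungrounded copies and meets y only at its end, is unaffected. *)
have yG' : y \in grounded a'.
  apply: contraLR isT => yN'.
  suff /setDP[yG' _] : y \in grounded a' :\: grounded a by rewrite yG' in yN'.
  have Dc := descendant_ind (a := a) (n := findex (parent a) y c).
  apply: Dc => [z pe az|]; last first.
    rewrite iter_findex // inE (grounded_child a_ok ac) yN (child' _ _ ac).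
    by rewrite /t tpermR.
  case/setDP=> pG' pN; rewrite inE (grounded_child a_ok az) pN (child' _ _ az).
  rewrite /t tpermD //; first by apply: contraNneq pN => <-.
  by apply: contraNneq yN' => ->.
(* As x and y are both grounded, exchanging their children loses nothing. *)
exists a' => //; apply/properP; split; last by exists y.
apply: grounded_sub => [|z pe az pG']; first exact: grounded_root.
by rewrite (child' _ _ az) /t; case: tpermP.
Qed.

Let fibre v := #|[set x | f x == v]|.

Hypothesis reach : forall y,
  exists2 r, r \in R & connect (supp_adj fibre) (f r) (f y).

(** When no grounded copy shares the vertex of y, the path from a start vertex
    to it leaves the set of vertices that have a grounded copy. *)
Lemma grounded_extend a y0 :
    assignment a -> y0 \notin grounded a ->
  exists2 a', assignment a' & grounded a \proper grounded a'.
Proof.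
move=> a_ok /(ungrounded_cycle a_ok)[y [c [e [yN ac yc]]]].
have [/exists_inP[x xG /eqP fxy]|yNA] :=
  boolP [exists x in grounded a, f x == f y].
  exact: swap_children xG yN fxy ac yc.
have [r /(subsetP (grounded_root a)) rG /connectP[p]] := reach y.
elim: p r rG => [|w p IHp] r rG /=.
  by move=> _ yr; case/exists_inP: yNA; exists r; rewrite ?yr.
case/andP=> /and3P[_ w_gt0 /existsP[d /andP[/eqP dr /eqP dw]]] wp yw.
have [/exists_inP[x xG /eqP fxw]|wNA] :=
  boolP [exists x in grounded a, f x == w].
  by rewrite -fxw in wp yw; apply: IHp xG wp yw.
have free z : z \in grounded a -> f z != w.
  by move=> zG; apply: contra wNA => fzw; apply/exists_inP; exists z.
move: w_gt0; rewrite card_gt0 => /set0Pn[x]; rewrite inE => /eqP fxw.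
have xN : x \notin grounded a.
  by apply: contraL (eqxx w) => /free; rewrite fxw.
by apply: reattach (a_ok) rG xN dr _ _; rewrite fxw.
Qed.

Lemma all_grounded a0 :
  assignment a0 -> exists2 a, assignment a & grounded a = [set: X].
Proof.
elim: {a0}(#|~: grounded a0|) {-2}a0 (leqnn #|~: grounded a0|) => [|n IHn] a0.
  rewrite leqn0 cards_eq0 => /eqP G0 a_ok; exists a0 => //.
  by rewrite -[grounded a0]setCK G0 setC0.
move=> le_n a_ok; have [/eqP GT|] := boolP (grounded a0 == setT).
  by exists a0.
rewrite -subTset => /subsetPn[y0 _ yN].
have [a' a'_ok lt_a'] := grounded_extend a_ok yN.
apply: IHn a'_ok; rewrite -ltnS; apply: leq_trans le_n.
by apply: proper_card; rewrite properC.
Qed.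

End Assignment.

(** * Existence of a parent assignment *)

Section InitialAssignment.
Variables (G : multigraph) (X : finType) (f : X -> vert G) (R : {set X}).

(** Slots over different vertices are different, since the edge of a slot ends
    at its vertex; so the injections can be chosen vertex by vertex, here by
    matching two enumerations. *)
Lemma assignment_exists :
    (forall w, #|[set x | f x == w] :\: R| <= #|slots f w|) ->
  exists a, assignment f R a.
Proof.
move=> le_slots; pose A w := [set x | f x == w] :\: R.
pose a x := if x \in R then None
            else onth (enum (slots f (f x))) (index x (enum (A (f x)))).
have a_slot x pe : a x = Some pe -> pe \in slots f (f x).
  rewrite /a; case: ifP => // _ ax; rewrite -mem_enum; apply/onthP.
  by exists (index x (enum (A (f x)))).
have A_mem x : x \notin R -> x \in enum (A (f x)).
  by move=> xNR; rewrite mem_enum !inE xNR eqxx.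
have index_lt x :
    x \notin R -> index x (enum (A (f x))) < size (enum (slots f (f x))).
  move=> xNR; rewrite -cardE; apply: leq_trans (le_slots _).
  by rewrite cardE index_mem A_mem.
exists a; split=> // [x|x y pe ax ay].
  rewrite /a; case: ifPn => // /index_lt; rewrite -onthTE.
  by case: (onth _ _).
have fxy : f x = f y.
  move: (a_slot _ _ ax) (a_slot _ _ ay); rewrite !inE.
  by case/andP=> _ /eqP<- /andP[_ /eqP<-].
move: ax ay; rewrite /a; case: ifPn => // xNR ax; case: ifPn => // yNR ay.
have := index_lt x xNR; have := A_mem y yNR; have := A_mem x xNR.
rewrite -fxy in ay *; rewrite -ay in ax => xA yA lt_x.
have Exy := onth_inj _ _ _ (enum_uniq _) (leq_ltn_trans (geq_minr _ _) lt_x) ax.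
by rewrite -(nth_index x xA) Exy nth_index.
Qed.

End InitialAssignment.

(** * From a grounded assignment to quota trees *)

Section Pieces.
Variables (G : multigraph) (X : finType) (f : X -> vert G) (R : {set X}).
Variable a : X -> option (X * edge G).
Hypotheses (a_ok : assignment f R a) (a_grounded : grounded R a = [set: X]).

Lemma ancestor_root x : exists n, iter n (parent a) x \in R.
Proof. by apply/grounded_iter; rewrite a_grounded. Qed.

Definition depth x : nat := ex_minn (ancestor_root x).
Definition root x : X := iter (depth x) (parent a) x.

Lemma root_in x : root x \in R.
Proof. by rewrite /root /depth; case: ex_minnP. Qed.

Lemma depth0 x : x \in R -> depth x = 0.
Proof.
move=> xR; apply/eqP; rewrite -leqn0 /depth.
by case: ex_minnP => n _; apply.
Qed.

Lemma root_id x : x \in R -> root x = x.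
Proof. by move=> xR; rewrite /root depth0. Qed.

Lemma depth_child c pe : a c = Some pe -> depth c = (depth pe.1).+1.
Proof.
move=> ac; rewrite /depth; case: ex_minnP => -[|n] cn cmin.
  by rewrite (assignment_root a_ok cn) in ac.
congr _.+1; rewrite iterSr (parentE ac) in cn.
case: ex_minnP => m pm pmin; apply/eqP; rewrite eqn_leq pmin // andbT -ltnS.
by apply: cmin; rewrite iterSr (parentE ac).
Qed.

Lemma root_child c pe : a c = Some pe -> root c = root pe.1.
Proof. by move=> ac; rewrite /root (depth_child ac) iterSr (parentE ac). Qed.

Section Piece.
Variable r : X.

Definition piece_vert := {x : X | root x == r}.
(** A tree has one edge for each non-root vertex: the pair of that vertex and
    its slot, from which both ends and the image in G can be read off. *)
Definition piece_edge :=
  {t : X * (X * edge G) | (a t.1 == Some t.2) && (root t.1 == r)}.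

Lemma piece_iniP (t : piece_edge) : root (val t).2.1 == r.
Proof. by case/andP: (valP t) => /eqP/root_child<-. Qed.

Lemma piece_terP (t : piece_edge) : root (val t).1 == r.
Proof. by case/andP: (valP t). Qed.

Definition piece : multigraph :=
  @Multigraph piece_vert piece_edge
    (fun t => exist (fun x => root x == r) _ (piece_iniP t))
    (fun t => exist (fun x => root x == r) _ (piece_terP t)).

Lemma piece_assigned (t : edge piece) : a (val t).1 = Some (val t).2.
Proof. by case/andP: (valP t) => /eqP. Qed.

Lemma piece_slot (t : edge piece) :
  ini (val t).2.2 = f (val (ini t)) /\ ter (val t).2.2 = f (val (ter t)).
Proof.
have [_ a_slot _] := a_ok; have := a_slot _ _ (piece_assigned t).
by rewrite inE => /andP[/eqP-> /eqP->].
Qed.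

Definition piece_map : gmap piece G :=
  @GMap piece G (fun u => f (val u)) (fun t => (val t).2.2)
    (fun t => proj1 (piece_slot t)) (fun t => proj2 (piece_slot t)).

Lemma piece_immersion : immersion piece_map.
Proof.
move=> u t t'; rewrite !inE => /eqP<- /eqP/(congr1 val) ini_eq edge_eq.
have Ett' : (val t').2 = (val t).2.
  move: ini_eq edge_eq => /=.
  by case: (sval t).2 (sval t').2 => [? ?] [? ?] /= -> ->.
have [_ _ a_inj] := a_ok; have := piece_assigned t'; rewrite Ett' => at'.
have Ext := a_inj _ _ _ (piece_assigned t) at'.
apply: val_inj.
by rewrite [LHS]surjective_pairing [RHS]surjective_pairing Ext Ett'.
Qed.

Hypothesis rR : r \in R.

Definition piece_root : vert piece :=
  exist (fun x => root x == r) r (introT eqP (root_id rR)).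

Lemma piece_arborescence : is_tree piece /\ directed_away_from piece_root.
Proof.
have ter_inj : injective (@ter piece).
  move=> t t' /(congr1 val) /= tt'; have := piece_assigned t.
  rewrite [(val t).1]tt' piece_assigned => -[Ett']; apply: val_inj.
  rewrite [LHS]surjective_pairing [RHS]surjective_pairing.
  by rewrite [(val t).1]tt' Ett'.
have depth_ter (t : edge piece) :
    depth (val (ter t)) = (depth (val (ini t))).+1.
  exact: depth_child (piece_assigned t).
have depth_r : depth (val piece_root) = 0 by apply: depth0.
have in_edge (u : vert piece) :
    u = piece_root \/ exists t : edge piece, ter t = u.
  have [uR|/(assignment_nonroot a_ok)[pe au]] := boolP (val u \in R).
    by left; apply: val_inj; rewrite /= -(root_id uR); apply/eqP/(valP u).
  have uP : (a (val u) == Some pe) && (root (val u) == r).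
    by rewrite au eqxx; apply: valP u.
  pose is_edge t := (a t.1 == Some t.2) && (root t.1 == r).
  by right; exists (exist is_edge (val u, pe) uP); apply: val_inj.
pose d (u : vert piece) := depth (val u).
split; first exact: (arborescence_tree (depth := d) ter_inj depth_ter in_edge).
exact: (arborescence_directed (depth := d) ter_inj depth_ter depth_r).
Qed.

Definition piece_quota (v : vert G) : nat :=
  #|[set u : vert piece | f (val u) == v]|.

Definition piece_quota_tree v (frv : f r = v) : quota_tree v piece_quota :=
  @QuotaTree _ _ _ _ piece_root (proj1 piece_arborescence)
    (proj2 piece_arborescence) piece_map piece_immersion frv (fun=> erefl).

End Piece.

Lemma sum_piece_quota w : \sum_(r in R) piece_quota r w = #|[set x | f x == w]|.
Proof.
rewrite -sum1dep_card [RHS](partition_big root (mem R)) => [|x _]; last first.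
  exact: root_in.
apply: eq_bigr => r _; rewrite sum1dep_card -[LHS](card_imset _ val_inj).
apply: eq_card => x; rewrite inE; apply/imsetP/andP=> [[u + ->]|[fx rx]].
  by rewrite inE => ->; split=> //; apply: valP u.
by exists (exist (fun x => root x == r) x rx); rewrite ?inE.
Qed.

End Pieces.

(** * Sufficiency of the three conditions *)

Section ForestSufficiency.
Variables (G : multigraph) (q s : vert G -> nat).
Hypothesis le_sq : forall v, s v <= q v.

Let copy : finType := {v : vert G & 'I_(q v)}.
Let mk v (i : 'I_(q v)) : copy := Tagged (fun v => 'I_(q v)) i.
Let f (x : copy) : vert G := tag x.
Let R : {set copy} := [set x : copy | tagged x < s (tag x)].

Lemma card_copies w : #|[set x | f x == w]| = q w.
Proof.
transitivity (\sum_(v | v == w) \sum_(i < q v) 1); last first.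
  by rewrite big_pred1_eq sum1_card card_ord.
by rewrite -sum1dep_card sig_big_dep; apply: eq_bigl => x; rewrite andbT.
Qed.

Lemma sum_roots (F : copy -> nat) :
  \sum_(x in R) F x =
  \sum_v \sum_(i < s v) F (mk (widen_ord (le_sq v) i)).
Proof.
under [RHS]eq_bigr => v _ do
  rewrite -(big_ord_narrow (F := fun i => F (mk i)) (le_sq v)).
rewrite (sig_big_dep xpredT (fun v (i : 'I_(q v)) => i < s v)
           (fun v i => F (mk i))) /=.
by apply: eq_big => [x|[]] //; rewrite inE.
Qed.

Lemma card_start_copies w : #|[set x | f x == w] :&: R| = s w.
Proof.
rewrite setIC -sum1_card; under eq_bigl => x do rewrite in_setI inE.
rewrite big_mkcondr sum_roots /= (bigD1 w) //= eqxx sum1_card card_ord.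
by rewrite big1 ?addn0 // => v /negPf->; rewrite big1.
Qed.

Lemma forest_exists :
    quota_connected q s ->
    (forall w, q w <= s w + \sum_v q v * arrows v w) ->
  inhabited (exact_quota_forest q s).
Proof.
move=> q_conn enough.
have [a0 a0_ok] : exists a, assignment f R a.
  apply: assignment_exists => w; rewrite card_slots cardsD card_copies.
  rewrite card_start_copies leq_subLR.
  by under eq_bigr => v _ do rewrite card_copies.
have reach y : exists2 r, r \in R &
    connect (supp_adj (fun v => #|[set x | f x == v]|)) (f r) (f y).
  have [|u [su uy]] := q_conn (f y).
    exact: leq_ltn_trans (ltn_ord (tagged y)).
  exists (mk (Ordinal (leq_trans su (le_sq u)))); first by rewrite inE.
  rewrite (eq_connect (e' := supp_adj q)) // => v w.
  by rewrite /supp_adj !card_copies.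
have [a a_ok aT] := all_grounded reach a0_ok.
have startR v (i : 'I_(s v)) : mk (widen_ord (le_sq v) i) \in R.
  by rewrite inE /=.
constructor; apply: (@ExactQuotaForest _ _ _ _
  (fun v i => piece_quota_tree a_ok aT (startR v i) (erefl v))) => w.
rewrite -(sum_roots (fun r => piece_quota a_ok aT r w)) sum_piece_quota.
exact: card_copies.
Qed.

End ForestSufficiency.

Theorem corollary8 (G : multigraph) (q s : vert G -> nat) :
  inhabited (exact_quota_forest q s) <->
  [/\ forall v : vert G, s v <= q v,
      quota_connected q s
    & forall w : vert G,
        q w <= s w + \sum_(v : vert G) q v * arrows v w].
Proof.
split=> [[F]|[le_sq q_conn enough]]; last exact: forest_exists.
split; [exact: forest_starts|exact: forest_connected|exact: forest_arrows].
Qed.
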